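(* Using a priority queue for the grades (the grade-queue variants described in the context), the algorithms Min_gens and Ker_basis produce the same output as in the Lesnick–Wright (LW) algorithm (the LW variants described in the context).
   Context: **Setting.** A graded matrix is a matrix over $\mathbb{Z}_2$ whose rows and columns are annotated with grades in $\mathbb{Z}^2$. A short chain complex $F^2\xrightarrow{\partial^2}F^1\xrightarrow{\partial^1}F^0$ of finitely generated free $2$-parameter persistence modules (functors $\mathbb{Z}^2\to\mathrm{Vec}_{\mathbb{Z}_2}$, for the product order on $\mathbb{Z}^2$, that are direct sums of modules $E^{\mathbf u}$ with $E^{\mathbf u}_{\mathbf z}=\mathbb{Z}_2$ for $\mathbf u\le\mathbf z$, $0$ otherwise, and identity maps between nonzero spaces) with $\partial^1\partial^2=0$ is given by graded matrices $A$ (for $\partial^2$) and $B$ (for $\partial^1$) with respect to ordered homogeneous bases; rows and columns carry the grades of the corresponding basis elements, so the grade of any row with a nonzero entry in a column is $\le$ the grade of the column. Rows and columns of the matrices are in co-lexicographic order of grades (compare $y$-coordinates first, then $x$-coordinates; equal grades ordered arbitrarily). All column grades lie in $\{1,\dots,X\}\times\{1,\dots,Y\}$. The pivot of a nonzero column is the largest row index with nonzero entry. Min_gens takes input $A$, and Ker_basis takes input $B$. **Reduction (LW).** A partial map $\rho$ from row indices to column indices is maintained, initially empty. Reducing column $j$ means: as long as column $j$ is nonzero with pivot $i$ and $\rho(i)=j'$ is defined with $j'<j$, add column $j'$ to column $j$. Afterwards column $j$ is marked visited, and if it is nonzero with pivot $i$, set $\rho(i)\leftarrow j$. **Min_gens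 (LW).** Traverse all grid cells $(x,y)\in\{1,\dots,X\}\times\{1,\dots,Y\}$ in lexicographic order ($x$ first, then $y$). At $(x,y)$: go through the columns with grade $(1,y),(2,y),\dots,(x-1,y)$ in that order and reduce them; then go through the columns with grade $(x,y)$ and reduce them; every column of grade $(x,y)$ not reducing to $0$ is appended (in its reduced form) to the output matrix with grade $(x,y)$. **Ker_basis (LW).** Each column $j$ has an auxiliary vector, initially the unit vector $e_j$; whenever column $j'$ is added to column $j$, the auxiliary vector of $j'$ is added to that of $j$. Traverse all grid cells in lexicographic order. At $(x,y)$: go through the columns with grade $(1,y),\dots,(x,y)$ in that order and reduce them; if a column turns from nonzero to zero during its reduction, append its auxiliary vector to the output matrix with grade $(x,y)$. Rows of the output inherit the grades of the columns of $B$. **Grade-queue variants.** A priority queue stores the grades that need to be visited, in lexicographic order; each grade present in it is handled once. It is initialized with the column grades of the matrix. Instead of iterating over all grid cells, the algorithm keeps popping the smallest grade from the queue until the queue is empty, and handles each popped grade exactly as in the LW variant above. The reduction is extended as follows: if at current grade $(x,y)$ the reduction of column $i$ stops because column $i$ is nonzero with pivot $j$ and $\rho(j)=k$ is defined with $k>i$, then, besides setting $\rho(j)\leftarrow i$, let $y'$ be the $y$-coordinate of the grade of column $k$; if $y'>y$, push $(x,y')$ to the queue. *)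

(* Defs.v *)
From HB Require Import structures.
From mathcomp Require Import all_boot all_order all_algebra.
Set Implicit Arguments.
Unset Strict Implicit.
Unset Printing Implicit Defensive.
Import Order.TTheory GRing.Theory Num.Theory.
Local Open Scope ring_scope.

Definition grade : Type := (int * int)%type.

Definition grade_le (u v : grade) : bool := (u.1 <= v.1) && (u.2 <= v.2).

Definition lex_le (u v : grade) : bool :=
  (u.1 < v.1) || (u.1 == v.1) && (u.2 <= v.2).

Definition colex_le (u v : grade) : bool :=
  (u.2 < v.2) || (u.2 == v.2) && (u.1 <= v.1).

Record gmatrix (m n : nat) := GMatrix {
  rgrade : {ffun 'I_m -> grade};
  cgrade : {ffun 'I_n -> grade};
  entries : 'M['F_2]_(m, n) }.

(* The condition for [entries M] to represent a morphism between the free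
   persistence modules with homogeneous bases of grades [cgrade M] and
   [rgrade M]. *)
Definition homogeneous m n (M : gmatrix m n) : Prop :=
  forall i j, entries M i j != 0 -> grade_le (rgrade M i) (cgrade M j).

Definition colex_ordered m n (M : gmatrix m n) : Prop :=
  (forall i i' : 'I_m, (i <= i')%N -> colex_le (rgrade M i) (rgrade M i')) /\
  (forall j j' : 'I_n, (j <= j')%N -> colex_le (cgrade M j) (cgrade M j')).

Definition in_grid (X Y : nat) m n (M : gmatrix m n) : Prop :=
  forall j, 1 <= (cgrade M j).1 <= X%:Z /\ 1 <= (cgrade M j).2 <= Y%:Z.

(* [A] and [B] represent d2 and d1 of a complex F2 -> F1 -> F0 of free modules
   of ranks n2, n1, n0, with the same homogeneous basis of F1 for both. *)
Record short_complex n0 n1 n2 (A : gmatrix n1 n2) (B : gmatrix n0 n1) : Prop :=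
  ShortComplex {
    homogeneous_d2 : homogeneous A;
    homogeneous_d1 : homogeneous B;
    same_basis : rgrade A = cgrade B;
    d1_d2 : entries B *m entries A = 0 }.

Definition pivot m (v : 'cV['F_2]_m) : option 'I_m :=
  [pick i : 'I_m | (v i 0 != 0) &&
                   [forall k : 'I_m, (v k 0 != 0) ==> (k <= i)%N]].

(* In a computation with fuel, [None] means that the fuel ran out. *)

Definition foldo S T (f : T -> S -> option S) (l : seq T) (s : S) : option S :=
  foldl (fun o t => obind (f t) o) (Some s) l.

Definition computes T (f : nat -> option T) (t : T) : Prop :=
  exists N, forall fuel, (N <= fuel)%N -> f fuel = Some t.

Definition set_at (I : finType) T (f : {ffun I -> T}) (i : I) (t : T) :
    {ffun I -> T} :=
  [ffun k => if k == i then t else f k].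

(* The priority queue is a lexicographically sorted sequence without
   duplicates. *)
Definition queue_of (s : seq grade) : seq grade := sort lex_le (undup s).

Definition push (g : grade) (q : seq grade) : seq grade := queue_of (g :: q).

(* [aux] is only read by Ker_basis, and [queue] only by the variants with a
   grade queue. *)
Record state (m n : nat) := State {
  cols : {ffun 'I_n -> 'cV['F_2]_m};
  aux : {ffun 'I_n -> 'cV['F_2]_n};
  rho : {ffun 'I_m -> option 'I_n};
  visited : {set 'I_n};
  queue : seq grade }.

Definition set_queue m n (s : state m n) (q : seq grade) : state m n :=
  State (cols s) (aux s) (rho s) (visited s) q.

Definition init_state m n (M : gmatrix m n) (q : seq grade) : state m n :=
  State [ffun j => col j (entries M)] [ffun j => delta_mx j 0]
        [ffun=> None] set0 q.

Definition add_col m n (j' j : 'I_n) (s : state m n) : state m n :=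
  State (set_at (cols s) j (cols s j + cols s j'))
        (set_at (aux s) j (aux s j + aux s j'))
        (rho s) (visited s) (queue s).

Definition pivot_owner m n (s : state m n) (j : 'I_n) : option 'I_n :=
  obind (fun i => rho s i) (pivot (cols s j)).

Fixpoint eliminate m n (fuel : nat) (j : 'I_n) (s : state m n) :
    option (state m n) :=
  if fuel isn't k.+1 then None else
  if pivot_owner s j is Some j' then
    if (j' < j)%N then eliminate k j (add_col j' j s) else Some s
  else Some s.

Definition finish m n (j : 'I_n) (s : state m n) : state m n :=
  State (cols s) (aux s)
        (if pivot (cols s j) is Some i then set_at (rho s) i (Some j)
         else rho s)
        (j |: visited s) (queue s).

(* To be applied before [finish], that is, before rho is overwritten. *)
Definition push_owner m n (M : gmatrix m n) (g : grade) (j : 'I_n)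
    (s : state m n) : state m n :=
  if pivot_owner s j is Some k then
    if (j < k)%N && (g.2 < (cgrade M k).2) then
      set_queue s (push (g.1, (cgrade M k).2) (queue s))
    else s
  else s.

(* The first argument is the current grade of the traversal. *)
Definition reduction m n : Type :=
  grade -> 'I_n -> state m n -> option (state m n).

Definition reduce_LW m n (fuel : nat) : reduction m n :=
  fun g j s => omap (finish j) (eliminate fuel j s).

Definition reduce_queue m n (M : gmatrix m n) (fuel : nat) : reduction m n :=
  fun g j s => omap (fun s' => finish j (push_owner M g j s'))
                    (eliminate fuel j s).

Definition upto (x : int) : seq int :=
  if x is Posz k then [seq i%:Z | i <- iota 1 k] else [::].

Definition cols_at m n (M : gmatrix m n) (g : grade) : seq 'I_n :=
  [seq j <- enum 'I_n | cgrade M j == g].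

Definition cols_upto m n (M : gmatrix m n) (g : grade) : seq 'I_n :=
  flatten [seq cols_at M (x, g.2) | x <- upto g.1].

(* The columns of the output matrix, of height p, with their grades. *)
Definition output p : Type := seq (grade * 'cV['F_2]_p).

Definition min_gens_at m n (M : gmatrix m n) (red : reduction m n) (g : grade)
    (r : state m n * output m) : option (state m n * output m) :=
  obind
    (fun s1 => foldo
      (fun j (r' : state m n * output m) =>
        omap (fun s' =>
               (s', if cols s' j != 0 then rcons r'.2 (g, cols s' j)
                    else r'.2))
             (red g j r'.1))
      (cols_at M g) (s1, r.2))
    (foldo (red g) (cols_upto M (g.1 - 1, g.2)) r.1).

Definition ker_basis_at m n (M : gmatrix m n) (red : reduction m n) (g : grade)
    (r : state m n * output n) : option (state m n * output n) :=
  foldo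
    (fun j (r' : state m n * output n) =>
      omap (fun s' =>
             (s', if (cols r'.1 j != 0) && (cols s' j == 0)
                  then rcons r'.2 (g, aux s' j) else r'.2))
           (red g j r'.1))
    (cols_upto M g) r.

Definition grid (X Y : nat) : seq grade :=
  [seq (x, y) | x <- upto X%:Z, y <- upto Y%:Z].

Definition traverse_grid m n p (X Y : nat) (M : gmatrix m n)
    (handle : grade -> state m n * output p -> option (state m n * output p)) :
    option (output p) :=
  omap snd (foldo handle (grid X Y) (init_state M [::], [::])).

Fixpoint queue_loop m n p (fuel : nat)
    (handle : grade -> state m n * output p -> option (state m n * output p))
    (r : state m n * output p) : option (state m n * output p) :=
  if fuel isn't k.+1 then None else
  if queue r.1 is g :: q then
    obind (queue_loop k handle) (handle g (set_queue r.1 q, r.2))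
  else Some r.

Definition traverse_queue m n p (fuel : nat) (M : gmatrix m n)
    (handle : grade -> state m n * output p -> option (state m n * output p)) :
    option (output p) :=
  omap snd
    (queue_loop fuel handle (init_state M (queue_of (codom (cgrade M))), [::])).

Definition output_matrix p (rg : {ffun 'I_p -> grade}) (o : output p) :
    {k : nat & gmatrix p k} :=
  existT _ (size o)
    (GMatrix rg [ffun j => (tnth (in_tuple o) j).1]
             (\matrix_(i, j) (tnth (in_tuple o) j).2 i 0)).

Definition min_gens_LW m n (X Y : nat) (A : gmatrix m n) (fuel : nat) :
    option {k : nat & gmatrix m k} :=
  omap (output_matrix (rgrade A))
    (traverse_grid X Y A (min_gens_at A (reduce_LW fuel))).

Definition min_gens_queue m n (A : gmatrix m n) (fuel : nat) :
    option {k : nat & gmatrix m k} :=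
  omap (output_matrix (rgrade A))
    (traverse_queue fuel A (min_gens_at A (reduce_queue A fuel))).

Definition ker_basis_LW m n (X Y : nat) (B : gmatrix m n) (fuel : nat) :
    option {k : nat & gmatrix n k} :=
  omap (output_matrix (cgrade B))
    (traverse_grid X Y B (ker_basis_at B (reduce_LW fuel))).

Definition ker_basis_queue m n (B : gmatrix m n) (fuel : nat) :
    option {k : nat & gmatrix n k} :=
  omap (output_matrix (cgrade B))
    (traverse_queue fuel B (ker_basis_at B (reduce_queue B fuel))).

(* Main.v *)
(* A cell that is not in the queue when the LW traversal reaches it leaves the
   LW state unchanged. Call a column settled if it has been visited and, when
   nonzero, owns its pivot; reducing a settled column changes nothing. A settled
   column k becomes unsettled only when a column j < k, reduced at some cell
   (x, y), takes over its pivot. By the colexicographic order the row y' of the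
   grade of k satisfies y' >= y. If y' > y, then (x, y') is pushed; if y' = y,
   then k is still to be reduced at (x, y). Hence each unsettled column keeps a
   grade in the queue that forces its reduction before LW could tell the
   difference, and the two traversals go through the same states. *)

Require Import Defs.
From mathcomp Require Import all_boot all_order all_algebra.
From mathcomp Require Import zify.
Set Implicit Arguments.
Unset Strict Implicit.
Unset Printing Implicit Defensive.
Import Order.TTheory GRing.Theory Num.Theory.

(** * Folds of partial steps and sorted sequences *)

Lemma foldo_cons S T (f : T -> S -> option S) t l s :
  foldo f (t :: l) s = obind (foldo f l) (f t s).
Proof.
rewrite /foldo /=; case: (f t s) => //=.
by elim: l => //= u l ->.
Qed.

Lemma foldo_cat S T (f : T -> S -> option S) l1 l2 s :
  foldo f (l1 ++ l2) s = obind (foldo f l2) (foldo f l1 s).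
Proof.
elim: l1 s => // t l1 IH s; rewrite cat_cons !foldo_cons.
by case: (f t s) => //= s'.
Qed.

Lemma eq_in_foldo S (T : eqType) (f f' : T -> S -> option S) l s :
  {in l, f =2 f'} -> foldo f l s = foldo f' l s.
Proof.
elim: l s => // t l IH s eq_ff'; rewrite !foldo_cons eq_ff' ?mem_head //.
case: (f' t s) => //= s'; apply: IH => u lu; apply: eq_ff'.
by rewrite inE lu orbT.
Qed.

(** An element of [s1] above [x] is also below it by sortedness, hence equal to [x]. This locates
    what is still to come: later cells of the grid, later columns of a cell. *)
Lemma mem_sorted_suffix (T : eqType) (leT : rel T) (s1 s2 : seq T) x y :
    transitive leT -> antisymmetric leT -> sorted leT (s1 ++ x :: s2) ->
  y \in s1 ++ x :: s2 -> leT x y -> y \in x :: s2.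
Proof.
move=> tr anti; rewrite sorted_pairwise // pairwise_cat.
move=> /andP[/allrelP s12 _].
rewrite mem_cat => /orP[s1y le_xy|//].
have /anti -> : leT y x && leT x y by rewrite le_xy s12 ?mem_head.
exact: mem_head.
Qed.

Lemma pairwise_allpairs_dep (I : eqType) (T J : eqType) (r : rel I) (r' : rel T)
    (F : I -> J -> T) (ys : I -> seq J) (xs : seq I) :
    pairwise r xs -> {in xs, forall x, pairwise r' [seq F x y | y <- ys x]} ->
    (forall x x', r x x' ->
       allrel r' [seq F x y | y <- ys x] [seq F x' y | y <- ys x']) ->
  pairwise r' [seq F x y | x <- xs, y <- ys x].
Proof.
move=> + + rr'; elim: xs => //= x xs IH /andP[rx rxs] r'xs.
rewrite pairwise_cat r'xs ?mem_head // IH // ?andbT; last first.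
  by move=> x' xs_x'; apply: r'xs; rewrite inE xs_x' orbT.
apply/allrelP => u v xu /allpairsPdep[x' [y [xs_x' y_y ->]]].
have /allrelP := rr' _ _ (allP rx _ xs_x').
by apply; rewrite ?map_f.
Qed.

Local Open Scope ring_scope.

(** * The lexicographic order, the grid and the queue *)

Lemma lex_le_trans : transitive lex_le.
Proof. move=> [a b] [c d] [e f]; rewrite /lex_le /=; lia. Qed.

Lemma lex_le_anti : antisymmetric lex_le.
Proof.
move=> [a b] [c d]; rewrite /lex_le /= => le_ge.
by apply/eqP; rewrite xpair_eqE; lia.
Qed.

Lemma lex_le_total : total lex_le.
Proof. move=> [a b] [c d]; rewrite /lex_le /=; lia. Qed.

Lemma mem_upto x z : (z \in upto x) = (1 <= z <= x).
Proof.
case: x => k /=; last by rewrite in_nil; lia.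
apply/mapP/idP => [[i]|z_k]; first by rewrite mem_iota => ? ->; lia.
by exists `|z|%N; rewrite ?mem_iota; lia.
Qed.

Lemma pairwise_upto x : pairwise <%R (upto x).
Proof.
case: x => //= k; rewrite pairwise_map.
have := iota_ltn_sorted 1 k.
by rewrite sorted_pairwise; [apply: sub_pairwise | exact: ltn_trans].
Qed.

Lemma mem_grid X Y (g : grade) :
  (g \in grid X Y) = [&& 1 <= g.1, g.1 <= X%:Z, 1 <= g.2 & g.2 <= Y%:Z].
Proof.
case: g => x y; rewrite -[RHS]/[&& 1 <= x, x <= X%:Z, 1 <= y & y <= Y%:Z].
rewrite andbA -!mem_upto.
apply/allpairsP/andP => [[[x' y'] /= [xX yY [-> ->]]] // | [xX yY]].
by exists (x, y).
Qed.

Lemma sorted_grid X Y : sorted lex_le (grid X Y).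
Proof.
apply/pairwise_sorted/(pairwise_allpairs_dep (pairwise_upto X)).
  move=> x _; rewrite pairwise_map; apply: sub_pairwise (pairwise_upto Y).
  by move=> y y' /=; rewrite /lex_le /=; lia.
move=> x x' lt_xx'; apply/allrelP => _ _ /mapP[y _ ->] /mapP[y' _ ->].
by rewrite /lex_le /= lt_xx'.
Qed.

Lemma grid_uniq X Y : uniq (grid X Y).
Proof.
have upto_uniq x : uniq (upto x).
  apply: sorted_uniq (pairwise_sorted (pairwise_upto x)) => //.
  exact: lt_trans.
by apply: allpairs_uniq => // -[x y] [x' y'] _ _ [-> ->].
Qed.

Lemma queue_sorted q : sorted lex_le (queue_of q).
Proof. exact/sort_sorted/lex_le_total. Qed.

Lemma queue_uniq q : uniq (queue_of q).
Proof. by rewrite sort_uniq undup_uniq. Qed.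

Lemma mem_queue q : queue_of q =i q.
Proof. by move=> g; rewrite mem_sort mem_undup. Qed.

(** * Columns met at a grid cell *)

Lemma mem_cols_at m n (M : gmatrix m n) g j :
  (j \in cols_at M g) = (cgrade M j == g).
Proof. by rewrite mem_filter mem_enum andbT. Qed.

Lemma mem_cols_upto m n (M : gmatrix m n) g j :
  (j \in cols_upto M g) =
  [&& 1 <= (cgrade M j).1, (cgrade M j).1 <= g.1 & (cgrade M j).2 == g.2].
Proof.
rewrite andbA -mem_upto; apply/flatten_mapP/andP.
  by case=> x gx; rewrite mem_cols_at => /eqP ->.
move=> [gj /eqP gj2]; exists (cgrade M j).1 => //.
by rewrite mem_cols_at -gj2 -surjective_pairing.
Qed.

(** The blocks share the row [g.2] and increase in x, so the colexicographic order makes their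
    indices increase; within a block, [enum] does. *)
Lemma sorted_cols_upto m n (M : gmatrix m n) g :
  colex_ordered M -> sorted (relpre val leq) (cols_upto M g).
Proof.
case=> _ colexM; apply: pairwise_sorted.
have -> : cols_upto M g =
  [seq id j | x <- upto g.1, j <- cols_at M (x, g.2)].
  by congr flatten; apply: eq_map => x; rewrite map_id.
apply: (pairwise_allpairs_dep (pairwise_upto g.1)) => [x _|x x' lt_xx'].
  rewrite map_id; apply: pairwise_filter; rewrite -pairwise_map.
  rewrite val_enum_ord -sorted_pairwise; last exact: leq_trans.
  exact: iota_sorted.
apply/allrelP => j j'; rewrite !map_id !mem_cols_at => /eqP gj /eqP gj'.
rewrite /= leqNgt; apply/negP => /ltnW /colexM.
by rewrite gj gj' /colex_le /=; lia.
Qed.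

(** Merges the two passes of Min_gens into one. For [g.1 <= 0] the left side is empty, although
    columns of grade [g] might exist. *)
Lemma cols_upto_last m n (M : gmatrix m n) g : 1 <= g.1 ->
  cols_upto M g = cols_upto M (g.1 - 1, g.2) ++ cols_at M g.
Proof.
case: g => [[[|k]|k] y] // _.
have -> : (Posz k.+1, y).1 - 1 = k by rewrite /=; lia.
have upto_k : upto (Posz k.+1) = upto k ++ [:: Posz k.+1].
  by rewrite /upto -[in LHS](addn1 k) iotaD map_cat.
rewrite {1}/cols_upto -[(Posz k.+1, y).1]/(Posz k.+1) upto_k.
by rewrite map_cat flatten_cat /= cats0.
Qed.

(** * Pivots over the field with two elements *)

Lemma pivotP m (v : 'cV['F_2]_m) i :
  pivot v = Some i <-> v i 0 != 0 /\ forall k, v k 0 != 0 -> (k <= i)%N.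
Proof.
rewrite /pivot; case: pickP => [i'|no_pivot].
  move=> /andP[vi' /forallP max_i']; split=> [[<-]|[vi max_i]].
    by split=> // k; apply/implyP.
  congr Some; apply/val_inj/anti_leq; rewrite max_i //=.
  by have /implyP := max_i' i; apply.
split=> // -[vi max_i]; have /andP[] := no_pivot i; split=> //.
by apply/forallP => k; apply/implyP/max_i.
Qed.

Lemma F2_addnn (x y : 'F_2) : x != 0 -> y != 0 -> x + y = 0.
Proof. by case: x y => [[|[|]]] // ? [[|[|]]] // ? _ _; apply: val_inj. Qed.

(** Termination measure of elimination; the shift by one reserves 0 for the zero column. *)
Definition pivot_height m (v : 'cV['F_2]_m) : nat :=
  if pivot v is Some i then i.+1 else 0.

Lemma pivot_height_leq m (v : 'cV['F_2]_m) : (pivot_height v <= m)%N.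
Proof. by rewrite /pivot_height; case: pivot. Qed.

Lemma pivot_height_add m (u v : 'cV['F_2]_m) i :
    pivot u = Some i -> pivot v = Some i ->
  (pivot_height (u + v)%R < pivot_height u)%N.
Proof.
rewrite /pivot_height => pu; rewrite pu.
move: pu => /pivotP[ui max_u] /pivotP[vi max_v].
case puv: pivot => [k|//]; move: puv => /pivotP[].
rewrite mxE => uvk _; rewrite ltnS ltn_neqAle.
apply/andP; split.
  by apply: contra uvk => /eqP/val_inj ->; rewrite F2_addnn.
have [uk0|/max_u //] := eqVneq (u k 0) 0.
by apply: max_v; rewrite uk0 add0r in uvk.
Qed.

(** * Reduction of a single column *)

Section Reduction.
Variables (m n : nat) (M : gmatrix m n).
Implicit Types (s : state m n) (j k : 'I_n) (g h : grade) (q l : seq grade).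

Definition rho_ok s : Prop := forall i k,
  rho s i = Some k -> k \in visited s /\ pivot (cols s k) = Some i.

Definition settled s k : bool :=
  (k \in visited s) &&
  (if pivot (cols s k) is Some i then rho s i == Some k else true).

Lemma set_queue_id s : set_queue s (queue s) = s.
Proof. by case: s. Qed.

Lemma settled_owner s j k : settled s j -> pivot_owner s j = Some k -> k = j.
Proof.
rewrite /settled /pivot_owner => /andP[_].
by case: pivot => //= i /eqP -> [].
Qed.

Lemma eliminate_settled fuel s j :
  (0 < fuel)%N -> settled s j -> eliminate fuel j s = Some s.
Proof.
case: fuel => //= fuel _ sj; case E: pivot_owner => [k|//].
by rewrite (settled_owner sj E) ltnn.
Qed.

Lemma finish_settled s j : settled s j -> finish j s = s.
Proof.
rewrite /settled /finish; case: s => c a r v q /= /andP[vj].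
rewrite (setUidPr _) ?sub1set //.
case: pivot => // i /eqP ri; congr State.
by apply/ffunP => k; rewrite ffunE; case: eqP => // ->.
Qed.

Lemma reduce_LW_settled fuel g s j :
  (0 < fuel)%N -> settled s j -> reduce_LW fuel g j s = Some s.
Proof.
by move=> fuel0 sj; rewrite /reduce_LW eliminate_settled //= finish_settled.
Qed.

(** Induction on [d], which bounds the number of additions. The witness [s1] depends neither on the
    fuel nor on the queue, so it serves both variants. *)
Lemma eliminateP d s j : (pivot_height (cols s j) <= d)%N -> rho_ok s ->
  exists s1,
  [/\ forall fuel q, (d < fuel)%N ->
        eliminate fuel j (set_queue s q) = Some (set_queue s1 q),
      rho s1 = rho s /\ visited s1 = visited s,
      forall k, k != j -> cols s1 k = cols s k,
      forall k, pivot_owner s1 j = Some k -> (j <= k)%N &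
      rho_ok s1].
Proof.
elim: d s => [|d IH] s le_d ok_s;
  case own: (pivot_owner s j) => [k|]; last 1 first.
- exists s; split=> // [[|fuel] //= q _|k]; rewrite ?own //.
  by rewrite [pivot_owner _ _]own.
- have := own; rewrite /pivot_owner; move: le_d; rewrite /pivot_height.
  by case: pivot.
- exists s; split=> // [[|fuel] //= q _|k]; rewrite ?own //.
  by rewrite [pivot_owner _ _]own.
have [le_jk|lt_kj] := leqP j k.
  exists s; split=> // [[|fuel] //= q _|k']; rewrite ?own; last by case=> <-.
  by rewrite [pivot_owner _ _]own ltnNge le_jk.
have [i pj rk] : exists2 i, pivot (cols s j) = Some i & rho s i = Some k.
  by move: own; rewrite /pivot_owner; case: pivot => // i ri; exists i.
have [_ pk] := ok_s _ _ rk.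
have [|i' k' /= rk'|s1 [E1 [E2 E3] E4 E5 E6]] := IH (add_col k j s).
- have := pivot_height_add pj pk.
  by move=> lt_h; rewrite /= ffunE eqxx -ltnS; apply: leq_trans lt_h le_d.
(* Altering column [j] damages no ownership: if [j] owned a pivot, it would be its current one,
   whose owner is [k < j]. *)
- have [vk' pk'] := ok_s _ _ rk'; split=> //; rewrite ffunE.
  case: eqP => // k'j; move: pk' rk'; rewrite k'j pj => -[<-].
  by rewrite rk => -[kj]; rewrite kj ltnn in lt_kj.
exists s1; split=> // [[|fuel] //= q lt_fuel|k' k'j].
  by rewrite [pivot_owner _ _]own lt_kj; apply: E1.
by rewrite E4 //= ffunE (negPf k'j).
Qed.

Lemma push_ownerP g j s q : exists2 q1,
    push_owner M g j (set_queue s q) = set_queue s q1 &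
    q1 = q /\ (forall k, pivot_owner s j = Some k -> (j < k)%N ->
                (cgrade M k).2 <= g.2) \/
    exists k, [/\ pivot_owner s j = Some k, (j < k)%N,
      g.2 < (cgrade M k).2 & q1 = push (g.1, (cgrade M k).2) q].
Proof.
rewrite /push_owner -[pivot_owner (set_queue s q) j]/(pivot_owner s j).
case own: (pivot_owner s j) => [k|]; last by exists q => //; left; split.
have [/andP[lt_jk lt_gk]|] := ifP; last first.
  move=> /negbT not_push; exists q => //; left; split=> // _ [<-] lt_jk.
  by rewrite leNgt; move: not_push; rewrite lt_jk.
by exists (push (g.1, (cgrade M k).2) q) => //; right; exists k.
Qed.

(* When g is the next cell of l, the first coordinate of such an h is that of
   g as soon as the first coordinate of the grade of k is at most that of g;
   so [pending] makes the queue visit column k before g.1 increases. *)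
Definition pending l q k : Prop := exists2 h : grade, h \in q &
  [/\ h.2 = (cgrade M k).2, (cgrade M k).1 <= h.1 &
      forall h', h' \in l -> h.1 <= Num.max (cgrade M k).1 h'.1].

(* The columns in r are those still to be reduced at the current cell, and l
   lists the cells after it. *)
Record invariant (r : seq 'I_n) l s q : Prop := Invariant {
  inv_rho : rho_ok s;
  inv_sorted : sorted lex_le q;
  inv_uniq : uniq q;
  inv_sub : {subset q <= l};
  inv_unsettled : forall k, ~~ settled s k -> k \in r \/ pending l q k }.

(** Needed for a column that loses its pivot: having been visited, it has a grade with x-coordinate
    at most [g.1]. *)
Definition visited_le g s : Prop :=
  forall k, k \in visited s -> lex_le (cgrade M k) g.

(** [finish] changes [rho] only at the pivot of [j], so [k] can suffer only if it owned that same
    pivot. *)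
Lemma settled_finish s j k : k != j -> settled s k ->
  ~~ settled (finish j s) k -> pivot_owner s j = Some k.
Proof.
rewrite /settled /pivot_owner /= => kj /andP[vk ok_k].
rewrite in_setU vk orbT /=; case pk: (pivot (cols s k)) ok_k => [i|//].
case pj: (pivot (cols s j)) => [i'|]; last by move=> ->.
move=> /eqP ri; rewrite ffunE; have [<- _|_] := eqVneq i i'; first by [].
by rewrite ri eqxx.
Qed.

Lemma rho_ok_finish s j : rho_ok s -> rho_ok (finish j s).
Proof.
move=> ok_s i k /=; rewrite in_setU in_set1.
case pj: (pivot (cols s j)) => [i'|]; last first.
  by move=> /ok_s[-> ->]; rewrite orbT.
rewrite ffunE; case: eqP => [-> [<-]|_ /ok_s[-> ->]]; last by rewrite orbT.
by rewrite eqxx.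
Qed.

Lemma settled_finish_self s j : settled (finish j s) j.
Proof.
rewrite /settled /= setU11 /=; case pj: (pivot (cols s j)) => [i|//].
by rewrite ffunE eqxx.
Qed.

(** Both variants take the same step apart from the queue. Only the previous owner of the new pivot
    of [j] can become unsettled; it then lies ahead in [r] or becomes pending through a push. *)
Lemma reduceP X Y g pre j r l s q : colex_ordered M -> in_grid X Y M ->
    pre ++ j :: r = cols_upto M g ->
    (forall h, h \in grid X Y -> lex_le g h -> h \in g :: l) ->
    (forall h, h \in l -> g.1 <= h.1) -> 1 <= g.1 <= X%:Z ->
    invariant (j :: r) l s q -> visited_le g s ->
  exists s1 q1,
  [/\ forall fuel, (m < fuel)%N -> reduce_LW fuel g j s = Some s1,
      forall fuel, (m < fuel)%N ->
        reduce_queue M fuel g j (set_queue s q) = Some (set_queue s1 q1),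
      invariant r l s1 q1 & visited_le g s1].
Proof.
move=> colexM gridM r_cols l_grid l_g g_grid.
move=> [ok_s q_sorted q_uniq q_sub uns] vis.
(* Pivot heights are at most [m], whence the bound [m < fuel]. *)
have [s1 [E1 [rho1 vis1] cols1 own1 ok_s1]] :=
  eliminateP (pivot_height_leq (cols s j)) ok_s.
have [q1 E2 q1P] := push_ownerP g j s1 q.
have gj :
  [&& 1 <= (cgrade M j).1, (cgrade M j).1 <= g.1 & (cgrade M j).2 == g.2].
  by rewrite -mem_cols_upto -r_cols mem_cat mem_head orbT.
(* A pushed grade is a grid cell strictly above [g] with the same x-coordinate, so it is still ahead
   in [l]. *)
have q1_sub : {subset q1 <= l}.
  case: q1P => [[-> _] //|[k [_ _ lt_gk ->]]] h; rewrite mem_queue inE.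
  case/predU1P => [->|/q_sub //].
  have [k1 k2] := gridM k.
  have : (g.1, (cgrade M k).2) \in g :: l.
    by apply: l_grid; rewrite ?mem_grid /lex_le /=; lia.
  rewrite inE => /predU1P[gk|//].
  by move: lt_gk; rewrite -gk /= ltxx.
have q_q1 : {subset q <= q1}.
  case: q1P => [[-> _] //|[k [_ _ _ ->]]] h qh.
  by rewrite mem_queue inE qh orbT.
have settled1 k : k != j -> settled s1 k = settled s k.
  by move=> kj; rewrite /settled vis1 rho1 cols1.
(* The LW run never touches the queue field, so its result keeps [queue s]. *)
exists (finish j (set_queue s1 (queue s))), q1; split.
- by move=> fuel lt_fuel; rewrite -{1}(set_queue_id s) /reduce_LW E1.
- by move=> fuel lt_fuel; rewrite /reduce_queue E1 //= E2.
- split=> //.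
  + exact: (@rho_ok_finish (set_queue s1 (queue s))).
  + by case: q1P => [[-> _] //|[k [_ _ _ ->]]]; apply: queue_sorted.
  + by case: q1P => [[-> _] //|[k [_ _ _ ->]]]; apply: queue_uniq.
  move=> k uns_k; have kj : k != j.
    by apply: contraNneq uns_k => ->; apply: settled_finish_self.
  have [s_k|/uns[]] := boolP (settled s k); last 2 first.
  + by rewrite inE (negPf kj) => ?; left.
  + by case=> h qh hP; right; exists h => //; apply: q_q1.
  have own : pivot_owner s1 j = Some k.
    have s1_k : settled s1 k by rewrite settled1.
    exact: settled_finish kj s1_k uns_k.
  have lt_jk : (j < k)%N by rewrite ltn_neqAle eq_sym kj own1.
  have vk : k \in visited s by case/andP: s_k.
  have := colexM.2 _ _ (ltnW lt_jk); rewrite /colex_le => le_jk.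
  have := vis _ vk; rewrite /lex_le => xk; have [k1 k2] := gridM k.
  have [lt_gk|le_kg] := ltP g.2 (cgrade M k).2; last first.
    (* Here [k] has row [g.2] and x-coordinate at most [g.1], so it belongs to the present cell; as
       [j < k], it comes after [j]. *)
    left; have : k \in j :: r.
      apply: (@mem_sorted_suffix _ (relpre val leq) pre).
      * by move=> ? ? ? /=; apply: leq_trans.
      * by move=> ? ? /anti_leq/val_inj.
      * by rewrite r_cols; apply: sorted_cols_upto.
      * by rewrite r_cols mem_cols_upto; lia.
      * exact: ltnW.
    by rewrite inE (negPf kj).
  (* Without a push, [push_ownerP] would contradict [lt_gk]. The pushed x-coordinate [g.1] is at
     most that of every later cell, as [pending] demands. *)
  right; case: q1P => [[_ /(_ _ own lt_jk)]|[k' [own' _ _ Dq1]]]; first lia.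
  move: own'; rewrite own => -[Dk]; exists (g.1, (cgrade M k).2).
    by rewrite Dq1 mem_queue Dk mem_head.
  split=> //= [|h /l_g]; first lia.
  by rewrite le_max => ->; exact: orbT.
- move=> k; rewrite /= in_setU in_set1 vis1 => /predU1P[->|]; last exact: vis.
  by move: gj; rewrite /lex_le; lia.
Qed.

(** * One cell, then the whole traversal *)

Section Handle.
Variable p : nat.
Implicit Types (o : output p) (red : reduction m n).
(** Abstracts the output rule: the two states are those before and after the reduction of the
    column. [upd_id] leaves out columns of grade [g], which Min_gens may output even when reduction
    does not change them. *)
Variable upd : grade -> 'I_n -> state m n -> state m n -> output p -> output p.
Hypothesis upd_queue : forall g j s s' q q' o,
  upd g j (set_queue s q) (set_queue s' q') o = upd g j s s' o.
Hypothesis upd_id : forall g j s o, cgrade M j != g -> upd g j s s o = o.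

Definition step red g j (r : state m n * output p) :=
  omap (fun s' => (s', upd g j r.1 s' r.2)) (red g j r.1).

Definition handle red g :
    state m n * output p -> option (state m n * output p) :=
  foldo (step red g) (cols_upto M g).

(** The processed prefix [pre] grows in the induction; [reduceP] needs it to place the remaining
    columns in the sorted list. *)
Lemma foldo_stepP X Y g pre r l s q o : colex_ordered M -> in_grid X Y M ->
    pre ++ r = cols_upto M g ->
    (forall h, h \in grid X Y -> lex_le g h -> h \in g :: l) ->
    (forall h, h \in l -> g.1 <= h.1) -> 1 <= g.1 <= X%:Z ->
    invariant r l s q -> visited_le g s ->
  exists s1 q1 o1,
  [/\ forall fuel, (m < fuel)%N ->
        foldo (step (reduce_LW fuel) g) r (s, o) = Some (s1, o1),
      forall fuel, (m < fuel)%N ->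
        foldo (step (reduce_queue M fuel) g) r (set_queue s q, o) =
          Some (set_queue s1 q1, o1),
      invariant [::] l s1 q1 & visited_le g s1].
Proof.
move=> colexM gridM r_cols l_grid l_g g_grid.
elim: r pre s q o r_cols => [|j r IH] pre s q o r_cols inv vis.
  by exists s, q, o.
have [s1 [q1 [E1 E2 inv1 vis1]]] :=
  reduceP colexM gridM r_cols l_grid l_g g_grid inv vis.
have r_cols1 : rcons pre j ++ r = cols_upto M g by rewrite cat_rcons.
have [s2 [q2 [o2 [E3 E4 inv2 vis2]]]] :=
  IH _ _ _ (upd g j s s1 o) r_cols1 inv1 vis1.
exists s2, q2, o2; split=> // fuel lt_fuel; rewrite foldo_cons.
  by rewrite /step /= E1 //= E3.
by rewrite /step /= E2 //= upd_queue E4.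
Qed.

(** The reason why LW does nothing at a cell absent from the queue. *)
Lemma handle_settled fuel g s o : (0 < fuel)%N ->
    {in cols_upto M g, forall j, settled s j && (cgrade M j != g)} ->
  handle (reduce_LW fuel) g (s, o) = Some (s, o).
Proof.
move=> fuel0; rewrite /handle; elim: (cols_upto M g) => // j r IH sr.
have /andP[sj gj] := sr _ (mem_head _ _).
rewrite foldo_cons /step /= reduce_LW_settled //= upd_id //.
by apply: IH => k rk; apply: sr; rewrite inE rk orbT.
Qed.

(** The equation is asked for [1 <= g.1], where [cols_upto_last] merges the passes of Min_gens; all
    grid cells satisfy this. *)
Variable handler : reduction m n -> grade -> state m n * output p ->
  option (state m n * output p).
Hypothesis handlerE : forall red g r,
  1 <= g.1 -> handler red g r = handle red g r.

(** Induction on the cells ahead of LW. The queue loop takes a turn only at queued cells, so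
    [size l] turns and a final look at the empty queue suffice. Visited columns have grades strictly
    before every cell of [l], so a column whose grade is the next cell is unvisited and forces that
    cell to be queued. *)
Lemma traverseP X Y pre l s q o : colex_ordered M -> in_grid X Y M ->
    pre ++ l = grid X Y -> invariant [::] l s q ->
    (forall h, h \in l ->
       forall k, k \in visited s ->
         lex_le (cgrade M k) h && (cgrade M k != h)) ->
  exists s1 o1,
  (forall fuel, (m < fuel)%N ->
     foldo (handler (reduce_LW fuel)) l (s, o) = Some (s1, o1)) /\
  (forall fuel d, (m < fuel)%N -> (size l < d)%N -> exists q1,
     queue_loop d (handler (reduce_queue M fuel)) (set_queue s q, o) =
       Some (set_queue s1 q1, o1)).
Proof.
move=> colexM gridM; elim: l pre s q o => [|g l IH] pre s q o l_grid inv vis.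
  have Dq : q = [::].
    case: q inv => // h q inv.
    by have := inv_sub inv (mem_head h q); rewrite in_nil.
  exists s, o; split=> // fuel [|d] // _ _; exists q.
  by rewrite /= Dq.
have sub_l h : h \in l -> h \in g :: l by rewrite inE orbC => ->.
have sorted_l : path lex_le g l.
  by have := sorted_grid X Y; rewrite -l_grid => /cat_sorted2[_].
have gl : g \notin l.
  by have := grid_uniq X Y; rewrite -l_grid cat_uniq => /and3P[_ _ /andP[]].
have le_gl h : h \in l -> lex_le g h.
  move=> lh; have := sorted_l; rewrite path_sortedE; last exact: lex_le_trans.
  by case/andP=> /allP/(_ _ lh).
have l_up h : h \in grid X Y -> lex_le g h -> h \in g :: l.
  rewrite -l_grid; apply: mem_sorted_suffix; rewrite ?l_grid.
  - exact: lex_le_trans.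
  - exact: lex_le_anti.
  - exact: sorted_grid.
have l_g1 h : h \in l -> g.1 <= h.1.
  by move=> /le_gl; rewrite /lex_le; lia.
have g_grid : 1 <= g.1 <= X%:Z.
  have : g \in grid X Y by rewrite -l_grid mem_cat mem_head orbT.
  by rewrite mem_grid => /and4P[-> ->].
have g1 : 1 <= g.1 by case/andP: g_grid.
have l_grid1 : rcons pre g ++ l = grid X Y by rewrite cat_rcons.
(* If the grade that makes [k] pending is [g] itself, then [k] is among the columns of this cell. *)
have g_cols h k : h.2 = (cgrade M k).2 -> (cgrade M k).1 <= h.1 -> h = g ->
    k \in cols_upto M g.
  by move=> h2 h1 <-; have [k1 k2] := gridM k; rewrite mem_cols_upto h2; lia.
have [qg|q'g] := boolP (g \in q).
  have vis_g : visited_le g s.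
    by move=> k /(vis _ (mem_head _ _)) /andP[].
  case: q inv qg => // h q inv qg.
  (* The head is at most [g] by sortedness of the queue, and at least [g] because the queue lies in
     [g :: l]. *)
  have h_g : h = g.
    apply: lex_le_anti; apply/andP; split.
      have := inv_sorted inv; rewrite /= path_sortedE; last exact: lex_le_trans.
      case/andP=> /allP h_q _; move: qg; rewrite inE => /predU1P[->|/h_q //].
      by have := lex_le_total h h; rewrite orbb.
    have := inv_sub inv (mem_head h q); rewrite inE => /predU1P[->|/le_gl //].
    by have := lex_le_total g g; rewrite orbb.
  move: inv; rewrite {}h_g {h qg} => -[ok_s q_sorted q_uniq q_sub uns].
  (* Popping [g] turns columns pending through [g] into columns to be reduced now. *)
  have inv1 : invariant (cols_upto M g) l s q.
    split=> // [||h qh|k /uns[//|[h]]]; first exact: path_sorted q_sorted.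
    - by case/andP: q_uniq.
    - have := q_sub h; rewrite !inE qh orbT => /(_ isT)/predU1P[hg|//].
      by move: q_uniq; rewrite /= -hg qh.
    rewrite inE => /predU1P[hg|qh] [h2 h1 hl].
      by left; apply: g_cols hg.
    by right; exists h => //; split=> // h' /sub_l; apply: hl.
  have [s1 [q1 [o1 [E1 E2 inv2 vis1]]]] :=
    foldo_stepP o colexM gridM (cat0s _) l_up l_g1 g_grid inv1 vis_g.
  have [|s2 [o2 [E3 E4]]] := IH _ s1 q1 o1 l_grid1 inv2.
    move=> h lh k vk; have le_kg := vis1 k vk.
    rewrite (lex_le_trans le_kg (le_gl _ lh)) /=.
    apply: contraNneq gl => kh; suff -> : g = h by [].
    by apply: lex_le_anti; rewrite le_gl //= -kh.
  exists s2, o2; split=> [fuel lt_fuel|fuel [|d] // lt_fuel lt_d].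
    by rewrite foldo_cons handlerE // /handle E1 //= E3.
  have [q2 E5] := E4 fuel d lt_fuel lt_d; exists q2.
  rewrite -E5 /= handlerE // /handle.
  by rewrite -[set_queue (set_queue _ _) _]/(set_queue s q) E2.
case: inv => ok_s q_sorted q_uniq q_sub uns.
have settled_g : {in cols_upto M g, forall j, settled s j && (cgrade M j != g)}.
  (* A witness [h] has row [g.2], and [h.1 <= g.1] by the clause on maxima; lying in [g :: l], it
     must be [g], which is not queued. *)
  have q_g j : j \in cols_upto M g -> ~ pending (g :: l) q j.
    rewrite mem_cols_upto => /and3P[j1 jg1 /eqP jg2] [h qh [h2 h1]].
    move=> /(_ g (mem_head _ _)) hmax.
    have := q_sub h qh; rewrite inE => /predU1P[hg|/l_g1 lh].
      by rewrite -hg qh in q'g.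
    suff hg : h = g by rewrite -hg qh in q'g.
    move: hmax; rewrite le_max => hmax.
    by apply: lex_le_anti; rewrite /lex_le; lia.
  move=> j gj; apply/andP; split.
    by apply: contraT => /uns[//|/(q_g _ gj)].
  (* A column of grade [g] would be unvisited, hence unsettled and pending, which [q_g] excludes. *)
  apply: contraNneq q'g => jg.
  have [/andP[vj _]|/uns[//|/(q_g _ gj) //]] := boolP (settled s j).
  by have := vis _ (mem_head g l) j vj; rewrite jg eqxx andbF.
have q_l : {subset q <= l}.
  move=> h qh; have := q_sub h qh; rewrite inE => /predU1P[hg|//].
  by rewrite -hg qh in q'g.
have inv1 : invariant [::] l s q.
  split=> // k /uns[//|[h qh [h2 h1 hl]]]; right; exists h => //.
  by split=> // h' /sub_l; apply: hl.
have [|s1 [o1 [E1 E2]]] := IH _ s q o l_grid1 inv1.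
  by move=> h /sub_l; apply: vis.
exists s1, o1; split=> [fuel lt_fuel|fuel d lt_fuel lt_d].
  rewrite foldo_cons handlerE // handle_settled //= ?E1 //.
  exact: leq_trans lt_fuel.
by apply: E2 => //; apply: ltnW.
Qed.

(** Nothing is visited at first, but every column is pending through its own grade. *)
Lemma invariant_init X Y : in_grid X Y M ->
  invariant [::] (grid X Y) (init_state M [::]) (queue_of (codom (cgrade M))).
Proof.
move=> gridM; split=> [i k||||k _].
- by rewrite /= ffunE.
- exact: queue_sorted.
- exact: queue_uniq.
- move=> h; rewrite mem_queue => /codomP[k ->].
  by have [k1 k2] := gridM k; rewrite mem_grid; lia.
right; exists (cgrade M k); first by rewrite mem_queue codom_f.
by split=> // h' _; rewrite le_max lexx.
Qed.

Lemma traverse_agree X Y : colex_ordered M -> in_grid X Y M ->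
  exists o,
    computes (fun fuel => traverse_grid X Y M (handler (reduce_LW fuel))) o /\
    computes (fun fuel =>
      traverse_queue fuel M (handler (reduce_queue M fuel))) o.
Proof.
move=> colexM gridM.
have [|s [o [E1 E2]]] :=
  @traverseP X Y [::] (grid X Y) (init_state M [::]) _ [::]
  colexM gridM erefl (invariant_init gridM).
  by move=> h _ k; rewrite /= in_set0.
exists o; split.
  by exists m.+1 => fuel lt_fuel; rewrite /traverse_grid E1.
(* The fuel must exceed [m] for each elimination and the number of cells for the queue loop. *)
exists (maxn m (size (grid X Y))).+1 => fuel.
rewrite gtn_max => /andP[lt_m lt_size]; rewrite /traverse_queue.
have [q Eq] := E2 _ _ lt_m lt_size.
by rewrite -[init_state _ _]/(set_queue (init_state M [::]) _) Eq.
Qed.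

End Handle.

End Reduction.

(** * Min_gens and Ker_basis as instances *)

Lemma computes_omap T U (h : T -> U) (f : nat -> option T) t :
  computes f t -> computes (fun fuel => omap h (f fuel)) (h t).
Proof. by case=> N fN; exists N => fuel /fN ->. Qed.

Definition min_gens_upd m n (M : gmatrix m n) (g : grade) (j : 'I_n)
    (s s' : state m n) (o : output m) : output m :=
  if (cgrade M j == g) && (cols s' j != 0) then rcons o (g, cols s' j) else o.

(** Columns of the first pass have x-coordinate below [g.1], so the grade test in [min_gens_upd]
    silences them; those of the second pass all satisfy it. *)
Lemma min_gens_atE m n (M : gmatrix m n) red g r : 1 <= g.1 ->
  min_gens_at M red g r = handle M (min_gens_upd M) red g r.
Proof.
move=> g1; rewrite /handle cols_upto_last // foldo_cat /min_gens_at.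
case: r => s o /=.
have -> :
    foldo (step (min_gens_upd M) red g) (cols_upto M (g.1 - 1, g.2)) (s, o) =
    omap (fun s' => (s', o)) (foldo (red g) (cols_upto M (g.1 - 1, g.2)) s).
  have : {in cols_upto M (g.1 - 1, g.2), forall j, cgrade M j != g}.
    move=> j; rewrite mem_cols_upto /= => gj; apply/eqP => jg.
    by move: gj; rewrite jg; lia.
  elim: (cols_upto M (g.1 - 1, g.2)) s => // j l IH s gl; rewrite !foldo_cons.
  rewrite /step /=; case: (red g j s) => //= s'.
  rewrite /min_gens_upd (negPf (gl _ (mem_head _ _))) /=; apply: IH => k lk.
  by apply: gl; rewrite inE lk orbT.
case: foldo => //= s'; apply: eq_in_foldo => j gj r.
by rewrite /step /min_gens_upd -mem_cols_at gj.
Qed.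

Definition ker_basis_upd m n (g : grade) (j : 'I_n)
    (s s' : state m n) (o : output n) : output n :=
  if (cols s j != 0) && (cols s' j == 0) then rcons o (g, aux s' j) else o.

Theorem proposition4p1 (X Y n0 n1 n2 : nat)
    (A : gmatrix n1 n2) (B : gmatrix n0 n1)
    (complexAB : short_complex A B)
    (colexA : colex_ordered A) (colexB : colex_ordered B)
    (gridA : in_grid X Y A) (gridB : in_grid X Y B) :
  (exists out : {k : nat & gmatrix n1 k},
     computes (min_gens_LW X Y A) out /\ computes (min_gens_queue A) out) /\
  (exists out : {k : nat & gmatrix n1 k},
     computes (ker_basis_LW X Y B) out /\ computes (ker_basis_queue B) out).
Proof.
split.
- have [||o [LW_o queue_o]] := @traverse_agree _ _ A _ (min_gens_upd A)
    _ _ (min_gens_at A) (@min_gens_atE _ _ A) X Y colexA gridA.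
  + by [].
  + by move=> g j s o gj; rewrite /min_gens_upd (negPf gj).
  by exists (output_matrix (rgrade A) o); split; apply: computes_omap.
(* [ker_basis_at] is already a single fold, equal to [handle] by conversion. *)
- have [||o [LW_o queue_o]] := @traverse_agree _ _ B _ (@ker_basis_upd n0 n1)
    _ _ (ker_basis_at B) (fun _ _ _ _ => erefl) X Y colexB gridB.
  + by [].
  (* An unchanged column cannot turn from nonzero to zero. *)
  + by move=> g j s o _; rewrite /ker_basis_upd andNb.
  by exists (output_matrix (cgrade B) o); split; apply: computes_omap.
Qed.
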